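(* Let $N(g)$ denote the number of numerical semigroups of genus $g$, let $\phi=(1+\sqrt5)/2$, and let \[ S=\lim_{g\to\infty}\frac{N(g)}{\phi^g} \] (this limit exists and is a finite positive constant). For integers $g,h\ge 0$ let $t(g,h)$ be the number of numerical semigroups of genus $g$ and efficacy $h$. Then, as $g\to\infty$, \[ \sum_{h\ge 0}\left| t(g,h)-S\phi^{g-h-2}\right| = o(\phi^g). \] In particular, for each fixed $h\ge 0$, $\lim_{g\to\infty} t(g,h)/N(g)=\phi^{-h-2}$.
   Context: A numerical semigroup is a subset $\Lambda\subseteq\mathbb{N}_0=\{0,1,2,\dots\}$ that contains $0$, is closed under addition, and has finite complement $\mathbb{N}_0\setminus\Lambda$. Its genus is $g(\Lambda)=|\mathbb{N}_0\setminus\Lambda|$ and its Frobenius number is $f(\Lambda)=\max(\mathbb{N}_0\setminus\Lambda)$, with the convention $f(\mathbb{N}_0)=-1$. The children of $\Lambda$ are the sets $\Lambda\setminus\{x\}$ with $x>f(\Lambda)$ that are again numerical semigroups; the efficacy $h(\Lambda)$ is the number of children of $\Lambda$. The existence of the limit $S$ is a known result (Zhai). *)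

(* Defs.v *)
From HB Require Import structures.
From mathcomp Require Import all_boot all_order all_algebra finmap.
From mathcomp Require Import all_classical all_reals all_analysis.
Import Order.TTheory GRing.Theory Num.Theory.
Import numFieldNormedType.Exports.
Set Implicit Arguments.
Unset Strict Implicit.
Unset Printing Implicit Defensive.
Local Open Scope classical_set_scope.
Local Open Scope ring_scope.

Definition numerical_semigroup (L : set nat) : Prop :=
  [/\ L 0%N, (forall x y : nat, L x -> L y -> L (x + y)%N)
    & finite_set (~` L)].

(* [fset_set A] is the empty set when [A] is infinite; the lemmas
   [finite_semigroups_of_genus], [finite_semigroups_of_genus_efficacy] and
   [finite_children] below show that every set counted with it is finite. *)
Definition genus (L : set nat) : nat := #|` fset_set (~` L)|.

(* An integer, because the Frobenius number of [setT] is -1. *)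
Definition frobenius (L : set nat) : int :=
  if `[< L = setT >] then - 1
  else (\max_(x <- fset_set (~` L)) x)%N%:Z.

Definition children (L : set nat) : set (set nat) :=
  [set L `\ x | x in [set x : nat |
     frobenius L < x%:Z /\ numerical_semigroup (L `\ x)]].

Definition efficacy (L : set nat) : nat := #|` fset_set (children L)|.

Definition semigroups_of_genus (g : nat) : set (set nat) :=
  [set L | numerical_semigroup L /\ genus L = g].

Definition semigroups_of_genus_efficacy (g h : nat) : set (set nat) :=
  [set L | [/\ numerical_semigroup L, genus L = g & efficacy L = h]].

Definition N (g : nat) : nat := #|` fset_set (semigroups_of_genus g)|.

Definition t (g h : nat) : nat :=
  #|` fset_set (semigroups_of_genus_efficacy g h)|.

Definition phi {R : realType} : R := (1 + Num.sqrt 5) / 2.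

(* The exponent is an integer, negative for [h > g - 2]. *)
Definition discrepancy {R : realType} (S : R) (g h : nat) : R :=
  `| (t g h)%:R - S * phi ^ (g%:Z - h%:Z - 2) |.

Lemma semigroup_conductor (L : set nat) (n : nat) :
  numerical_semigroup L -> (2 * genus L <= n)%N -> L n.
Proof.
move=> [L0 LD Lfin] len; apply: contrapT => Ln.
suff : (n.+1 <= 2 * genus L)%N by rewrite ltnNge len.
pose G : seq nat := fset_set (~` L).
have inG (x : nat) : ~ L x -> x \in G.
  by move=> Lx; rewrite /G in_fset_set// inE.
rewrite -(size_iota 0 n.+1).
suff /uniq_leq_size : {subset iota 0 n.+1 <= G ++ [seq (n - x)%N | x <- G]}.
  by rewrite size_cat size_map mul2n -addnn => ->//; exact: iota_uniq.
move=> x; rewrite mem_iota add0n ltnS /= => xn; rewrite mem_cat.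
have [Lx|Lx] := pselect (L x); last by rewrite inG.
apply/orP; right; apply/mapP; exists (n - x)%N; last by rewrite subKn.
by apply: inG => Lnx; apply: Ln; rewrite -(subnKC xn); exact: LD.
Qed.

Lemma finite_semigroups_of_genus (g : nat) :
  finite_set (semigroups_of_genus g).
Proof.
pose f (A : {set 'I_(2 * g)}) : set nat :=
  [set n | forall i : 'I_(2 * g), i \in A -> nat_of_ord i <> n].
apply: (@sub_finite_set _ _ (f @` setT)); last exact: finite_image.
move=> L [Ls Lg]; exists [set i : 'I_(2 * g) | `[< ~ L i >]]%SET => //.
apply/seteqP; split => n /=; last first.
  by move=> Ln i; rewrite inE => /asboolP Li iE; apply: Li; rewrite iE.
move=> fn; have [gn|ng] := leqP (2 * g) n.
  by apply: semigroup_conductor; rewrite ?Lg.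
apply: contrapT => Ln; apply: (fn (Ordinal ng)) => //.
by rewrite inE; exact/asboolP.
Qed.

Lemma finite_semigroups_of_genus_efficacy (g h : nat) :
  finite_set (semigroups_of_genus_efficacy g h).
Proof.
by apply: sub_finite_set (finite_semigroups_of_genus g) => L [].
Qed.

Lemma frobenius_lt (L : set nat) (x : nat) :
  finite_set (~` L) -> frobenius L < x%:Z -> L x.
Proof.
rewrite /frobenius => Lfin; case: asboolP => [->//|_].
rewrite ltz_nat => mx; apply: contrapT => Lx.
have xG : x \in (fset_set (~` L) : seq nat) by rewrite in_fset_set// inE.
by have := @leq_bigmax_seq _ _ predT id x xG isT; rewrite leqNgt mx.
Qed.

Lemma finite_children (L : set nat) :
  numerical_semigroup L -> finite_set (children L).
Proof.
move=> [L0 LD Lfin].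
apply: sub_finite_set (finite_semigroups_of_genus (genus L).+1).
move=> _ [x [fx xs] <-]; split => //.
have Lx := frobenius_lt Lfin fx.
have -> : genus (L `\ x) = #|` fset_set (x |` ~` L)|.
  rewrite /genus; congr (#|` fset_set _|); apply/seteqP; split => y /=.
    move=> nLy; have [->|yx] := eqVneq y x; [by left|right => Ly].
    by apply: nLy; split => //; exact/eqP.
  by move=> [->|nLy] [].
have xG : x \notin fset_set (~` L).
  by apply/negP; rewrite in_fset_set// inE => /(_ Lx).
by rewrite fset_setU1// cardfsU1 xG add1n.
Qed.

(* Main.v *)
(** In the tree of numerical semigroups, the effective generators of a child
    [L] of [P] are those generators of [P] larger than the removed element
    [F], plus possibly [F + m], with [m] the multiplicity of [L]; when [F < m],
    also [2 F] can be new, but then [F + m] is new too. Call [L] weak if it has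
    no new generator, and strong otherwise. A semigroup with more than [k]
    effective generators has exactly one child inheriting [k] of them, so
    [t (g + 1) k] is the number of semigroups of genus [g] and efficacy
    greater than [k], up to the number of strong semigroups of genus [g + 1].

    Strong semigroups are exponentially rare compared with [phi ^ g]: as
    [F + m] is not a sum of two positive elements, the Kunz coordinates obey
    [k_i + k_j > q] for [i + j = r] and [k_i + k_j >= q] for [i + j = m + r],
    where [F = (q - 1) m + r]. Weighting a Kunz vector by [(2/3) ^ genus], each
    such pair contributes a factor at most 1, so there are at most
    [4 g ^ 3 (3/2) ^ g] strong semigroups of genus [g], and [3/2 < phi].

    Hence the proportions of efficacy [>= k] satisfy a perturbed linear
    recurrence with contraction factor [1/phi], which gives their limits by
    induction on [k]; the convergence of the sum of the discrepancies follows
    as in Scheffe's lemma, the tails having the same total mass. *)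

Require Import Defs.
From HB Require Import structures.
From mathcomp Require Import all_boot all_order all_algebra finmap.
From mathcomp Require Import all_classical all_reals all_analysis.
From mathcomp Require Import zify ring lra.
Import Order.TTheory GRing.Theory Num.Theory.
Import numFieldNormedType.Exports.
Set Implicit Arguments.
Unset Strict Implicit.
Unset Printing Implicit Defensive.
Local Open Scope classical_set_scope.
Local Open Scope ring_scope.

(** * Weight of the Kunz vectors of strong semigroups *)

(* Lists of length [n] with entries in [1, q] whose opposite entries
   [nth s i] and [nth s (n - 1 - i)] have sum larger than [q], except that the
   middle entry (if any) is not compared with itself. *)
Fixpoint opposed_lists (q n : nat) : seq (seq nat) :=
  match n with
  | 0 => [:: [::]]
  | 1 => [seq [:: a] | a <- iota 1 q]
  | n'.+2 => [seq p.1 :: rcons s p.2 |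
      p <- [seq (a, (q.+1 - a + j)%N) | a <- iota 1 q, j <- iota 0 a],
      s <- opposed_lists q n']
  end.

Lemma mem_opposed_lists (q n : nat) (s : seq nat) :
  size s = n -> (forall i, (i < n)%N -> (1 <= nth 0%N s i <= q)%N) ->
  (forall i, (i < n)%N -> (q < nth 0%N s i + nth 0%N s (n.-1 - i))%N) ->
  s \in opposed_lists q n.
Proof.
suff P m : forall s : seq nat, size s = m ->
    (forall i, (i < m)%N -> (1 <= nth 0%N s i <= q)%N) ->
    (forall i, (i < m)%N -> (q < nth 0%N s i + nth 0%N s (m.-1 - i))%N) ->
    s \in opposed_lists q m by exact: P.
have [k mk] := ubnP m; elim: k => // k IH in m mk *.
case: m mk => [|[|m]] mk {}s.
- by move=> /size0nil ->.
- case: s => [|a [|]] //= _ /(_ 0%N isT) /= ? _.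
  by apply/mapP; exists a => //; rewrite mem_iota; lia.
case: s => [|a s] //=; case/lastP: s => [|s b] //=.
rewrite size_rcons => -[sm] sq sp.
have ha := sq 0%N isT; have hb := sq m.+1 (ltnSn _).
have hab := sp 0%N isT.
rewrite /= ?subn0 nth_rcons sm ltnn eqxx /= in ha hb hab.
apply/allpairsP; exists ((a, b), s); split => //=.
(* By [q < a + b], the entry [b] exceeds its least admissible value [q.+1 - a] by some [j], and
   [b <= q] gives [j < a]. *)
- apply/allpairsPdep; exists a, (b - (q.+1 - a))%N.
  rewrite !mem_iota; split; [lia|lia|congr (_, _); lia].
- apply: IH => //; first lia.
    move=> i im; have := sq i.+1; rewrite /= nth_rcons sm im; apply; lia.
  move=> i im; have := sp i.+1.
  have -> : (m.+1 - i.+1 = (m.-1 - i).+1)%N by lia.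
  rewrite /= !nth_rcons sm im.
  have -> : (m.-1 - i < m)%N by lia.
  by apply; lia.
Qed.

(* The weight 2/3 is larger than [1 / phi], yet small enough for
   [pair_weight_le1]. *)
Section Weight.
Variable R : realFieldType.
Local Notation x := (2 / 3 : R).
Local Notation w s := (x ^+ sumn s).

Lemma sum_weight_iota1 (a : nat) :
  \sum_(j <- iota 1 a) x ^+ j = 2 * (1 - x ^+ a).
Proof.
elim: a => [|a IH]; first by rewrite big_nil expr0 subrr mulr0.
by rewrite -[a.+1]addn1 iotaD big_cat big_seq1 /= IH add1n addn1 exprS; field.
Qed.

(** With [y = (2/3) ^ q], the geometric sums give the closed form [2 y (q - 2 + 2 y)]. Once
    [q y <= 1/2], this is at most [1 - 4 y (1 - y) <= 1]. There is little room: the value at [q = 4]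
    is about 0.946. *)
Lemma pair_weight_le1 (q : nat) :
  \sum_(a <- iota 1 q) \sum_(j <- iota 0 a) x ^+ (a + (q.+1 - a + j)) <= 1.
Proof.
have geo a : \sum_(j <- iota 0 a) x ^+ j = 3 * (1 - x ^+ a).
  elim: a => [|a IH]; first by rewrite big_nil expr0 subrr mulr0.
  by rewrite -[a.+1]addn1 iotaD big_cat big_seq1 /= IH add0n exprD expr1; field.
have -> : \sum_(a <- iota 1 q) \sum_(j <- iota 0 a)
    x ^+ (a + (q.+1 - a + j)) = 2 * x ^+ q * (q%:R - 2 + 2 * x ^+ q).
  transitivity (\sum_(a <- iota 1 q) (3 * x ^+ q.+1) * (1 - x ^+ a)).
    rewrite big_seq_cond [RHS]big_seq_cond; apply: eq_bigr => a.
    rewrite mem_iota andbT => ha.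
    rewrite mulrAC -geo mulr_suml; apply: eq_bigr => j _.
    by rewrite -exprD; congr (_ ^+ _); lia.
  rewrite -mulr_sumr sumrB sum_weight_iota1 big_const_seq count_predT size_iota.
  by rewrite iter_addr_0 exprS; field.
(* The inequality [q (2/3) ^ q <= 1/2] fails at [q = 6] and holds from 7 on; the smaller cases are
   computed. *)
have [|q7] := ltnP q 7.
  by case: q => [|[|[|[|[|[|[|q]]]]]]] // _; lra.
have y1 : 0 <= x ^+ q <= 1 by rewrite exprn_ge0 ?exprn_ile1 //; lra.
have qy : q%:R * x ^+ q <= 1 / 2.
  rewrite -(subnK q7); elim: (q - 7)%N => [|n IH]; first by lra.
  rewrite addSn exprS -natr1.
  have : 0 <= x ^+ (n + 7) by rewrite exprn_ge0 //; lra.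
  have : 7 <= (n + 7)%:R :> R by rewrite natrD lerDr.
  move: IH; nra.
nra.
Qed.

(** Each outer pair peeled off costs a factor at most 1, by [pair_weight_le1]. What remains is the
    empty list, of weight 1, or a free middle entry, of total weight below 2. *)
Lemma opposed_lists_weight (q n : nat) : \sum_(s <- opposed_lists q n) w s <= 2.
Proof.
have [k nk] := ubnP n; elim: k => // k IH in n nk *.
case: n nk => [|[|n]] nk.
- by rewrite /= big_seq1 /= expr0 ler1n.
- rewrite /= big_map /=.
  under eq_bigr do rewrite addn0.
  rewrite sum_weight_iota1.
  have : 0 <= x ^+ q by rewrite exprn_ge0 //; lra.
  lra.
rewrite [opposed_lists _ _]/= big_allpairs_dep.
under eq_bigr => p _.
  under eq_bigr => s _ do
    rewrite /= -cats1 sumn_cat /= addn0 addnCA addnC exprD.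
  rewrite -mulr_sumr; over.
rewrite -mulr_suml big_allpairs_dep /= -[leRHS]mul1r.
apply: ler_pM; last first.
- by apply: IH; lia.
- exact: pair_weight_le1.
- by apply: sumr_ge0 => s _; rewrite exprn_ge0 //; lra.
- apply: sumr_ge0 => s _; apply: sumr_ge0 => j _.
  by rewrite exprn_ge0 //; lra.
Qed.

(* In [u ++ q :: v] the entry [q] is the Kunz coordinate of the residue
   [r = (size u).+1] of the Frobenius number; pairs of indices with sum [r] are
   opposite in [u], those with sum [m + r] are opposite in [v]. *)
Definition kunz_candidates (g : nat) : seq (seq nat) :=
  [seq p.1.2 ++ p.1.1 :: p.2 |
    p <- [seq (r, v) |
      r <- [seq (q, u) | q <- iota 1 g, u <- [seq u | a <- iota 0 g,
                                                   u <- opposed_lists q a]],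
      v <- [seq v | b <- iota 0 g, v <- opposed_lists r.1.-1 b]]].

(** There are [g] choices of [q], whose own weight is bounded by 1, and [g] lengths for each of [u]
    and [v], each contributing at most 2. *)
Lemma kunz_candidates_weight (g : nat) :
  \sum_(s <- kunz_candidates g) w s <= 4 * g%:R ^+ 3.
Proof.
have w0 s : 0 <= w s by rewrite exprn_ge0 //; lra.
have L q : 0 <= \sum_(u <- [seq u | a <- iota 0 g, u <- opposed_lists q a]) w u
    <= 2 * g%:R.
  rewrite sumr_ge0//= big_allpairs_dep /= [leRHS]mulrC.
  apply: (@le_trans _ _ (\sum_(a <- iota 0 g) 2)).
    by apply: ler_sum => a _; exact: opposed_lists_weight.
  by rewrite big_const_seq count_predT size_iota iter_addr_0 mulr_natl.
rewrite big_map !big_allpairs_dep /=.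
apply: (@le_trans _ _ (\sum_(q <- iota 1 g) 4 * g%:R ^+ 2)); last first.
  rewrite big_const_seq count_predT size_iota iter_addr_0 -[leLHS]mulr_natr.
  by rewrite -mulrA -exprSr.
apply: ler_sum => q _.
have /andP[h1 h2] := L q; have /andP[h3 h4] := L q.-1.
apply: (@le_trans _ _ ((\sum_(u <- [seq u | a <- iota 0 g,
  u <- opposed_lists q a]) w u) * (\sum_(u <- [seq u | a <- iota 0 g,
  u <- opposed_lists q.-1 a]) w u))); last by nra.
rewrite mulr_suml; apply: ler_sum => u _.
rewrite mulr_sumr; apply: ler_sum => v _.
rewrite sumn_cat /= exprD ler_wpM2l ?exprn_ge0 ?exprD; try by lra.
rewrite ler_piMl ?exprn_ge0 ?exprn_ile1 //; lra.
Qed.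

End Weight.

(** * Parents and effective generators *)

Section FsetSetCardinal.
Variables T U : choiceType.
Implicit Types A B C : set T.

Lemma card_fset_set_inj A (B : set U) (f : T -> U) :
  finite_set A -> finite_set B -> (forall x, A x -> B (f x)) ->
  {in A &, injective f} -> (#|` fset_set A| <= #|` fset_set B|)%N.
Proof.
move=> Afin Bfin fAB finj.
have <- : #|` fset_set (f @` A)| = #|` fset_set A|.
  by apply/fcard_eq => //; [exact: finite_image|exact: inj_card_eq].
apply/fsubset_leq_card; rewrite -fset_set_sub//; last exact: finite_image.
by move=> _ [x Ax <-]; exact: fAB.
Qed.

Lemma card_fset_set_image A (f : T -> U) :
  finite_set A -> (#|` fset_set (f @` A)| <= #|` fset_set A|)%N.
Proof. by move=> Afin; rewrite fset_set_image//; exact: leq_imfset_card. Qed.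

Lemma card_fset_set_sub A B : finite_set B -> A `<=` B ->
  (#|` fset_set A| <= #|` fset_set B|)%N.
Proof.
move=> Bfin AB; have Afin := sub_finite_set AB Bfin.
by apply/fsubset_leq_card; rewrite -fset_set_sub.
Qed.

Lemma card_fset_set_setU A B : finite_set A -> finite_set B ->
  (#|` fset_set (A `|` B)| <= #|` fset_set A| + #|` fset_set B|)%N.
Proof. by move=> Afin Bfin; rewrite fset_setU// -cardfsUI leq_addr. Qed.

Lemma card_fset_set_disjoint A B : finite_set A -> finite_set B ->
  A `&` B = set0 ->
  #|` fset_set (A `|` B)| = (#|` fset_set A| + #|` fset_set B|)%N.
Proof.
move=> Afin Bfin AB0; rewrite fset_setU// -cardfsUI -fset_setI// AB0.
by rewrite fset_set0 cardfs0 addn0.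
Qed.

End FsetSetCardinal.

(** Moving to a larger element of [A] strictly lowers the count above it. This recovers the element
    removed from a parent. *)
Lemma card_above_inj (A : set nat) (x y : nat) : finite_set A -> A x -> A y ->
  #|` fset_set [set z | A z /\ (x < z)%N]| =
  #|` fset_set [set z | A z /\ (y < z)%N]| -> x = y.
Proof.
move=> Afin.
have fin u : finite_set [set z | A z /\ (u < z)%N].
  by apply: sub_finite_set Afin => z [].
have lt u v : A v -> (u < v)%N ->
    (#|` fset_set [set z | A z /\ (v < z)%N]| <
     #|` fset_set [set z | A z /\ (u < z)%N]|)%N.
  move=> Av uv.
  suff <- : #|` fset_set (v |` [set z | A z /\ (v < z)%N])| =
      #|` fset_set [set z | A z /\ (v < z)%N]|.+1.
    apply: card_fset_set_sub => // z [->|[Az vz]] //.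
    by split => //; exact: ltn_trans vz.
  rewrite fset_setU1// cardfsU1 in_fset_set//.
  by rewrite memNset ?add1n//= => -[_]; rewrite ltnn.
move=> Ax Ay e; case: (ltngtP x y) => // xy.
  by have := lt _ _ Ay xy; rewrite e ltnn.
by have := lt _ _ Ax xy; rewrite e ltnn.
Qed.

(** Induction removing the least element [x]: either the others number exactly [k] and [x] works, or
    the witness is found among them, where [x] does not affect the count. *)
Lemma exists_card_above (A : set nat) (k : nat) : finite_set A ->
  (k < #|` fset_set A|)%N ->
  exists2 x, A x & #|` fset_set [set z | A z /\ (x < z)%N]| = k.
Proof.
have [n] := ubnP #|` fset_set A|; elim: n => // n IH in A * => An Afin kA.
have [x0 Ax0] : A !=set0.
  apply/set0P/negP => /eqP A0; by rewrite A0 fset_set0 cardfs0 in kA.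
have [x /asboolP Ax xmin] := @ex_minnP (fun x => `[< A x >])
  (ex_intro _ x0 (introT (asboolP _) Ax0)).
have Bfin : finite_set (A `\ x) by apply: sub_finite_set Afin => z [].
have AE : A = x |` (A `\ x) by rewrite setDUK// => _ ->.
have cA : #|` fset_set A| = #|` fset_set (A `\ x)|.+1.
  rewrite {1}AE fset_setU1// cardfsU1 in_fset_set//.
  by rewrite memNset ?add1n//= => -[].
have above z : A z /\ (x < z)%N <-> (A `\ x) z.
  split => [[Az xz]|[Az zx]]; split => //;
    first by move=> zx; rewrite zx ltnn in xz.
  rewrite ltn_neqAle xmin ?andbT; last exact/asboolP.
  by apply/eqP => xz; exact: zx.
have := kA; rewrite cA ltnS leq_eqVlt => /orP[/eqP->|kB].
  by exists x => //; congr (#|` fset_set _|); apply/seteqP; split => z /above.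
have [|y By yk] := IH (A `\ x) _ Bfin kB; first by rewrite -ltnS -cA.
exists y; first by case: By.
rewrite -yk; congr (#|` fset_set _|); apply/seteqP; split => z /= [Az yz];
  split => //; last by case: Az.
apply/above; split => //; apply: ltn_trans yz; exact: (proj2 (above y) By).2.
Qed.

(** * Frobenius number, effective generators and parent *)

Definition least (P : set nat) : nat :=
  xget 0%N [set n | P n /\ forall j, (j < n)%N -> ~ P j].

Lemma leastP (P : set nat) : P !=set0 ->
  P (least P) /\ forall j, (j < least P)%N -> ~ P j.
Proof.
move=> [n Pn]; rewrite /least; case: xgetP => [_ _ []//|nP]; exfalso.
have [m /asboolP Pm mmin] := @ex_minnP (fun x => `[< P x >])
  (ex_intro _ n (introT (asboolP _) Pn)).
apply: (nP m); split => // j jm /asboolP /mmin; by rewrite leqNgt jm.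
Qed.

(* A natural number, unlike [frobenius]; junk value [0] on [setT]. *)
Definition frob (L : set nat) : nat :=
  least [set F | forall y, (F < y)%N -> L y].

(** If [frob L] were in [L], its predecessor would contradict minimality, or, when [frob L] is 0,
    [L] would be [setT]. *)
Lemma frobP (L : set nat) : numerical_semigroup L -> L != setT ->
  ~ L (frob L) /\ forall y, (frob L < y)%N -> L y.
Proof.
move=> Ls LT; have [|h min] := @leastP [set F | forall y, (F < y)%N -> L y].
  by exists (2 * genus L)%N => y /ltnW; exact: semigroup_conductor.
split => // LF; rewrite -/(frob L) in h min LF *.
case E : (frob L) => [|f].
  move/eqP: LT; apply; apply/seteqP; split => // y _.
  by have [/h//|] := ltnP (frob L) y; rewrite E leqn0 => /eqP->; rewrite -E.
apply: (min f); rewrite ?E// => y; rewrite leq_eqVlt => /orP[/eqP<-|].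
  by rewrite -E.
by rewrite -E; exact: h.
Qed.

Lemma frob_unique (L : set nat) (F : nat) : numerical_semigroup L ->
  ~ L F -> (forall y, (F < y)%N -> L y) -> frob L = F.
Proof.
move=> Ls LF hF; have LT : L != setT.
  by apply/eqP => LE; apply: LF; rewrite LE.
have [h1 h2] := frobP Ls LT.
by case: (ltngtP (frob L) F) => // [/h2|/hF].
Qed.

(** The minimal generators above the Frobenius number. Saying that everything from [x] on lies in
    [L] avoids a separate case for [setT]. *)
Definition effective (L : set nat) : set nat :=
  [set x | (forall y, (x <= y)%N -> L y) /\ numerical_semigroup (L `\ x)].

Lemma lt_frobeniusP (L : set nat) (x : nat) : numerical_semigroup L ->
  frobenius L < x%:Z <-> forall y, (x <= y)%N -> L y.
Proof.
move=> [L0 _ Lfin]; split => [fx y xy|h].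
  by apply: frobenius_lt => //; apply: lt_le_trans fx _; rewrite lez_nat.
rewrite /frobenius; case: asboolP => [//|LT].
rewrite ltz_nat; case: x h => [h|x h].
  by exfalso; apply: LT; apply/seteqP; split => // y _; exact: h.
rewrite ltnS; apply/bigmax_leqP_seq => y; rewrite in_fset_set// inE => Ly _.
by rewrite leqNgt; apply/negP => /h.
Qed.

Lemma childrenE (L : set nat) : numerical_semigroup L ->
  children L = [set L `\ x | x in effective L].
Proof.
move=> Ls; rewrite /children; congr (image _ _).
by apply/seteqP; split => x [] /(lt_frobeniusP _ Ls).
Qed.

Lemma setD1_inj (L : set nat) (x y : nat) : L x -> L `\ x = L `\ y -> x = y.
Proof.
move=> Lx e; apply: contrapT => xy.
by have : (L `\ y) x by []; rewrite -e => -[_]; exact.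
Qed.

Lemma effective_setD1_inj (L : set nat) :
  {in effective L &, injective (fun x => L `\ x)}.
Proof.
by move=> x y; rewrite !inE => -[Lx _] _; apply: setD1_inj; exact: Lx.
Qed.

Lemma finite_effective (L : set nat) : numerical_semigroup L ->
  finite_set (effective L).
Proof.
move=> Ls; rewrite -(eq_finite_set (inj_card_eq (@effective_setD1_inj L))).
by rewrite -childrenE//; exact: finite_children.
Qed.

Lemma efficacyE (L : set nat) : numerical_semigroup L ->
  efficacy L = #|` fset_set (effective L)|.
Proof.
move=> Ls; rewrite /efficacy childrenE//.
apply/fcard_eq; last exact/inj_card_eq/effective_setD1_inj.
  by apply: finite_image; exact: finite_effective.
exact: finite_effective.
Qed.

Lemma genus_setU1 (L : set nat) (x : nat) : finite_set (~` L) -> ~ L x ->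
  genus L = (genus (x |` L)).+1.
Proof.
move=> Lfin Lx; rewrite /genus.
have E : ~` L = x |` ~` (x |` L).
  apply/seteqP; split => y /= => [Ly|[->//|xLy Ly]]; last by apply: xLy; right.
  by have [->|/eqP yx] := eqVneq y x; [left|right => -[]].
have fin : finite_set (~` (x |` L)).
  by apply: sub_finite_set Lfin => y /= xLy Ly; apply: xLy; right.
rewrite E fset_setU1// cardfsU1 in_fset_set//.
by rewrite memNset ?add1n//= => h; apply: h; left.
Qed.

Definition parent (L : set nat) : set nat := frob L |` L.

Definition weak (L : set nat) : Prop := effective L `<=` effective (parent L).

Section Parent.
Variable L : set nat.
Hypotheses (Ls : numerical_semigroup L) (LT : L != setT).

Lemma parent_semigroup : numerical_semigroup (parent L).
Proof.
have [nF F] := frobP Ls LT; have [L0 LD Lfin] := Ls.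
have FD y : parent L (frob L + y)%N.
  by case: y => [|y]; [left; rewrite addn0|right; apply: F; lia].
split => [|x y|]; first by right.
- move=> [->|Lx]; first by move=> _; exact: FD.
  by move=> [->|Ly]; [rewrite addnC; exact: FD|right; exact: LD].
- by apply: sub_finite_set Lfin => y /= xLy Ly; apply: xLy; right.
Qed.

Lemma parentK : parent L `\ frob L = L.
Proof.
have [nF _] := frobP Ls LT.
apply/seteqP; split => y; first by move=> [[]].
by move=> Ly; split; [right|move=> yF; apply: nF; rewrite -yF].
Qed.

Lemma genus_parent : genus L = (genus (parent L)).+1.
Proof. by apply: genus_setU1; [case: Ls|case: (frobP Ls LT)]. Qed.

Lemma effective_parent_frob : effective (parent L) (frob L).
Proof.
have [_ F] := frobP Ls LT; split; last by rewrite parentK.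
by move=> y; rewrite leq_eqVlt => /orP[/eqP<-|/F]; [left|right].
Qed.

Lemma effective_gt_frob x : effective L x -> (frob L < x)%N.
Proof.
have [nF _] := frobP Ls LT => -[Lx _].
by rewrite ltnNge; apply/negP => /Lx.
Qed.

(** An element that is not a sum in the parent is not a sum in the smaller semigroup [L] either. *)
Lemma effective_of_parent x : (frob L < x)%N -> effective (parent L) x ->
  effective L x.
Proof.
have [nF F] := frobP Ls LT; have [L0 LD Lfin] := Ls.
move=> Fx [_ [[_ x0] xD _]]; split.
  by move=> y xy; apply: F; exact: leq_trans xy.
split => //; last first.
  have : finite_set (x |` ~` L) by rewrite finite_setU; split.
  apply: sub_finite_set => y nLy.
  have [->|/eqP yx] := eqVneq y x; first by left.
  by right => Ly; apply: nLy; split.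
move=> a b [La ax] [Lb bx]; split; first exact: LD.
by apply: (xD a b _ _).2; split => //; right.
Qed.

Lemma weak_effectiveE : weak L ->
  effective L = [set y | effective (parent L) y /\ (frob L < y)%N].
Proof.
move=> w; apply/seteqP; split => y /=.
  by move=> Ly; split; [exact: w|exact: effective_gt_frob].
by move=> [Py Fy]; exact: effective_of_parent.
Qed.

End Parent.

Lemma effective_child (L : set nat) (x : nat) : numerical_semigroup L ->
  effective L x ->
  [/\ numerical_semigroup (L `\ x), L `\ x != setT, frob (L `\ x) = x
    & parent (L `\ x) = L].
Proof.
move=> Ls [Lx xs]; have nx : ~ (L `\ x) x by move=> [_]; apply.
have fx : frob (L `\ x) = x.
  apply: frob_unique => // y xy; split; first exact/Lx/ltnW.
  by move=> yx; rewrite yx ltnn in xy.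
split => //.
  by apply/eqP => e; apply: nx; rewrite e.
by rewrite /parent fx setDUK// => _ ->; exact: Lx.
Qed.

Lemma positive_genus (L : set nat) : numerical_semigroup L ->
  (0 < genus L)%N = (L != setT).
Proof.
move=> [L0 LD Lfin]; apply/idP/idP => [+|/eqP LT].
  by apply: contraTneq => ->; rewrite /genus setCT fset_set0 cardfs0.
rewrite lt0n; apply/eqP => /cardfs0_eq g0; apply: LT.
apply/seteqP; split => // y _; apply: contrapT => Ly.
have : y \in fset_set (~` L) by rewrite in_fset_set// inE.
by rewrite g0 in_fset0.
Qed.

(** * Recurrence between consecutive genera *)

Definition semigroups_of_efficacy_ge (g k : nat) : set (set nat) :=
  [set L | [/\ numerical_semigroup L, genus L = g & (k <= efficacy L)%N]].

Definition strong_semigroups (g : nat) : set (set nat) :=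
  [set L | [/\ numerical_semigroup L, genus L = g & ~ weak L]].

Definition tail (g k : nat) : nat :=
  #|` fset_set (semigroups_of_efficacy_ge g k)|.

Definition nstrong (g : nat) : nat := #|` fset_set (strong_semigroups g)|.

Lemma finite_efficacy_ge (g k : nat) :
  finite_set (semigroups_of_efficacy_ge g k).
Proof. by apply: sub_finite_set (finite_semigroups_of_genus g) => L []. Qed.

Lemma finite_strong_semigroups (g : nat) : finite_set (strong_semigroups g).
Proof. by apply: sub_finite_set (finite_semigroups_of_genus g) => L []. Qed.

Lemma tail0 (g : nat) : tail g 0 = N g.
Proof.
congr (#|` fset_set _|); apply/seteqP; split => L [Ls Lg] //.
Qed.

Lemma tailS (g k : nat) : tail g k = (t g k + tail g k.+1)%N.
Proof.
rewrite -card_fset_set_disjoint; last first.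
- apply/seteqP; split => // L [[_ _ ek] [_ _]].
  by rewrite ek ltnn.
- exact: finite_efficacy_ge.
- exact: finite_semigroups_of_genus_efficacy.
congr (#|` fset_set _|); apply/seteqP; split => L.
  move=> [Ls Lg]; rewrite leq_eqVlt => /orP[/eqP ek|kL].
    by left; split; last exact/esym.
  by right; split.
by move=> [[Ls Lg <-]|[Ls Lg kL]]; split => //; exact: ltnW.
Qed.

(* [parent] is injective on the weak semigroups of efficacy [k]: the removed
   element is the effective generator of the parent with [k] larger ones. *)
Lemma t_le_tail (g k : nat) : (t g.+1 k <= tail g k.+1 + nstrong g.+1)%N.
Proof.
pose A := semigroups_of_genus_efficacy g.+1 k `&` weak.
have Afin : finite_set A.
  apply: sub_finite_set (finite_semigroups_of_genus_efficacy g.+1 k) => L [] //.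
have T L : A L -> L != setT.
  by move=> [[Ls Lg _] _]; rewrite -positive_genus// Lg.
apply: (@leq_trans (#|` fset_set A| + nstrong g.+1)).
  rewrite -[t _ _]/(#|` fset_set (semigroups_of_genus_efficacy g.+1 k)|).
  apply: leq_trans (card_fset_set_setU Afin (finite_strong_semigroups g.+1)).
  apply: card_fset_set_sub.
    by rewrite finite_setU; split => //; exact: finite_strong_semigroups.
  move=> L [Ls Lg Lk].
  by have [w|w] := pselect (weak L); [left|right]; split.
rewrite leq_add2r.
have rank L : A L ->
    #|` fset_set [set z | effective (parent L) z /\ (frob L < z)%N]| = k.
  move=> AL; have [[Ls Lg Lk] w] := AL.
  by rewrite -weak_effectiveE ?T// -efficacyE.
apply: (@card_fset_set_inj _ _ _ _ parent) => //.
- exact: finite_efficacy_ge.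
- move=> L AL; have [[Ls Lg Lk] w] := AL.
  have Ps := parent_semigroup Ls (T _ AL).
  split => //; first by apply/eqP; rewrite -eqSS -genus_parent// ?Lg// T.
  rewrite efficacyE// -Lk efficacyE// weak_effectiveE ?T//.
  (* The removed element is itself effective in the parent, whence [k.+1] instead of [k]. *)
  have <- : #|` fset_set (frob L |` [set z | effective (parent L) z /\
      (frob L < z)%N])| = #|` fset_set [set z | effective (parent L) z /\
      (frob L < z)%N]|.+1.
    rewrite fset_setU1; last first.
      by apply: sub_finite_set (finite_effective Ps) => z [].
    rewrite cardfsU1 in_fset_set; last first.
      by apply: sub_finite_set (finite_effective Ps) => z [].
    by rewrite memNset ?add1n//= => -[_]; rewrite ltnn.
  apply: card_fset_set_sub; first exact: finite_effective.
  by move=> z [->|[]//]; apply: effective_parent_frob => //; exact: T.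
- move=> L1 L2; rewrite !inE => A1 A2 e.
  have [[s1 _ _] _] := A1; have [[s2 _ _] _] := A2.
  rewrite -(parentK s1 (T _ A1)) -(parentK s2 (T _ A2)) e.
  congr (_ `\ _); apply: (@card_above_inj (effective (parent L1))).
  - exact/finite_effective/parent_semigroup/T.
  - exact/effective_parent_frob/T.
  - by rewrite e; exact/effective_parent_frob/T.
  - by rewrite rank// e rank.
Qed.

(** Removing the effective generator with exactly [k] larger ones gives a child that has efficacy
    [k] if weak, and is strong otherwise. Since [parent] undoes this, its image covers the
    semigroups counted by [tail g k.+1]. *)
Lemma tail_le_t (g k : nat) : (tail g k.+1 <= t g.+1 k + nstrong g.+1)%N.
Proof.
have Cfin : finite_set
    (semigroups_of_genus_efficacy g.+1 k `|` strong_semigroups g.+1).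
  rewrite finite_setU; split; first exact: finite_semigroups_of_genus_efficacy.
  exact: finite_strong_semigroups.
apply: leq_trans (card_fset_set_setU
  (finite_semigroups_of_genus_efficacy g.+1 k) (finite_strong_semigroups g.+1)).
apply: leq_trans (card_fset_set_image parent Cfin).
apply: card_fset_set_sub; first exact: finite_image.
move=> L [Ls Lg]; rewrite efficacyE// => kL.
have [x Ex xk] := exists_card_above (finite_effective Ls) kL.
have [xs xT fx px] := effective_child Ls Ex.
exists (L `\ x) => //.
have gx : genus (L `\ x) = g.+1 by rewrite genus_parent// px Lg.
have [w|w] := pselect (weak (L `\ x)); [left|right]; split => //.
by rewrite efficacyE// weak_effectiveE// fx px.
Qed.

(** A new generator [x] is a sum in the parent but not in [L], so [x = F + d] with [F = frob L]. If
    [F + m] were a sum in [L], then every such [x] would be one too. *)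
Lemma strong_sum_ne (L : set nat) (m a b : nat) : numerical_semigroup L ->
  L != setT -> ~ weak L -> L m -> (0 < m)%N ->
  (forall y, L y -> (0 < y)%N -> (m <= y)%N) ->
  L a -> L b -> (0 < a)%N -> (0 < b)%N -> (a + b)%N <> (frob L + m)%N.
Proof.
move=> Ls LT nw Lm m0 mmin La Lb a0 b0.
have [nF F] := frobP Ls LT; have [L0 LD Lfin] := Ls.
move=> abF; have ma := mmin _ La a0; have mb := mmin _ Lb b0.
(* Both [a] and [b] are at least [m], so [a + b = F + m] forces [m <= F]; equality fails because [F]
   is a gap. *)
have [mF|] := ltnP m (frob L); last first.
  rewrite leq_eqVlt => /orP[/eqP Fm|]; last by lia.
  by apply: nF; rewrite Fm.
have Ps := parent_semigroup Ls LT.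
have [x [Ex nEx]] : exists x, effective L x /\ ~ effective (parent L) x.
  apply: contrapT => /forallNP h; apply: nw => x Lx.
  by apply: contrapT => Px; apply: (h x).
have Fx := effective_gt_frob Ls LT Ex.
have [Lx [[_ x0] xD _]] := Ex.
have xF c d : L c -> L d -> c <> x -> d <> x -> (c + d)%N <> x.
  by move=> Lc Ld cx dx; apply: (xD c d _ _).2.
have Fb d : parent L d -> d <> x -> (frob L + d)%N = x -> False.
  move=> Pd dx dE.
  have md : (m <= d)%N.
    by case: Pd => [->|Ld]; [exact: ltnW|apply: mmin => //; lia].
  (* For [d = m], [x] is the forbidden sum [a + b]. For [d > m], it is [(F + d - m) + m], whose
     first term exceeds [F] and so lies in [L]. *)
  have [dm|dm] := eqVneq d m.
    by apply: (xF a b) => //; lia.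
  apply: (xF (frob L + d - m)%N m) => //; [apply: F| | |]; lia.
apply: nEx; split; first by move=> y /Lx; right.
split.
- by split => //; right.
- move=> c d [Pc cx] [Pd dx]; split; first by case: Ps => _ + _; apply.
  move=> cdx; have [[cF|Lc] [dF|Ld]] := (Pc, Pd).
  + by apply: (Fb d) => //; rewrite -cF.
  + by apply: (Fb d) => //; rewrite -cF.
  + by apply: (Fb c) => //; rewrite -dF addnC.
  + exact: (xF c d).
- have : finite_set (x |` ~` L) by rewrite finite_setU; split.
  apply: sub_finite_set => y nLy.
  have [->|/eqP yx] := eqVneq y x; first by left.
  by right => Ly; apply: nLy; split => //; right.
Qed.

(** * Kunz vectors *)

Definition mult (L : set nat) : nat := least [set n | L n /\ (0 < n)%N].

Definition kunz_coord (L : set nat) (i : nat) : nat :=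
  least [set k | L (k * mult L + i)%N].

(** Position [i] holds the coordinate of the residue [i.+1]; residue 0 is left out, its coordinate
    being 0. *)
Definition kunz (L : set nat) : seq nat :=
  [seq kunz_coord L i | i <- iota 1 (mult L).-1].

Section Kunz.
Variable L : set nat.
Hypothesis Ls : numerical_semigroup L.
Local Notation m := (mult L).

Lemma multP : [/\ L m, (0 < m)%N & forall y, L y -> (0 < y)%N -> (m <= y)%N].
Proof.
have [|[Lm m0] mmin] := @leastP [set n | L n /\ (0 < n)%N].
  by exists (2 * genus L).+1; split => //; exact: semigroup_conductor.
split => // y Ly y0; rewrite leqNgt; apply/negP => ym.
by apply: (mmin y).
Qed.

(** As [m] is in [L], membership within a residue class is preserved by adding [m]. *)
Lemma kunz_coordP (i k : nat) : L (k * m + i)%N <-> (kunz_coord L i <= k)%N.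
Proof.
have [Lm m0 _] := multP; have [L0 LD _] := Ls.
have [|h min] := @leastP [set k | L (k * m + i)%N].
  exists (2 * genus L)%N; apply: (semigroup_conductor Ls).
  by apply: leq_trans (leq_addr _ _); exact: leq_pmulr.
rewrite -/(kunz_coord L i) in h min; split => [Lk|].
  by rewrite leqNgt; apply/negP => /min.
move=> /subnK <-; elim: (k - _)%N => // n IH.
by rewrite addSn mulSn -addnA; exact: LD.
Qed.

Lemma kunz_coord_gt0 (i : nat) : (0 < i < m)%N -> (0 < kunz_coord L i)%N.
Proof.
have [_ _ mmin] := multP; move=> /andP[i0 im].
rewrite ltnNge; apply/negP => /kunz_coordP; rewrite mul0n add0n => Li.
by have := mmin _ Li i0; rewrite leqNgt im.
Qed.

Lemma size_kunz : (size (kunz L)).+1 = m.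
Proof.
by have [_ m0 _] := multP; rewrite size_map size_iota prednK.
Qed.

Lemma kunz_memP (n : nat) : L n <->
  (n %% m == 0)%N || (nth 0%N (kunz L) (n %% m).-1 <= n %/ m)%N.
Proof.
have [Lm m0 _] := multP; have [L0 LD _] := Ls.
have [r0|r0] := posnP (n %% m).
  split => // _; rewrite (divn_eq n m) r0 addn0.
  by elim: (n %/ m)%N => // k IH; rewrite mulSn; exact: LD.
have rm : (n %% m < m)%N by rewrite ltn_mod.
rewrite (nth_map 0%N) ?size_iota; last by lia.
rewrite nth_iota; last by lia.
rewrite add1n prednK// orFb {1}(divn_eq n m).
exact: kunz_coordP.
Qed.

(** The gaps of residue [i] are the [k * m + i] with [k < kunz_coord L i]; the list [G] enumerates
    all gaps once. *)
Lemma sumn_kunz : sumn (kunz L) = genus L.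
Proof.
have [Lm m0 mmin] := multP; have [L0 LD Lfin] := Ls.
pose G := [seq (k * m + i)%N | i <- iota 1 m.-1, k <- iota 0 (kunz_coord L i)].
transitivity (size G).
  rewrite size_allpairs_dep /kunz; congr sumn.
  by apply: eq_map => i; rewrite size_iota.
apply/perm_size/uniq_perm.
- apply: allpairs_uniq_dep => [|i _|]; [exact: iota_uniq..|].
  move=> _ _ /allpairsPdep[i [k [+ _ ->]]] /allpairsPdep[j [l [+ _ ->]]] /=.
  rewrite !mem_iota => hi hj e.
  have ij : i = j.
    have := congr1 (modn^~ m) e; rewrite /= !modnMDl !modn_small //; lia.
  rewrite -{}ij in e *; congr (Tagged _ _).
  by move: e => /addIn/eqP; rewrite eqn_pmul2r// => /eqP.
- exact: fset_uniq.
move=> n; rewrite in_fset_set//; apply/allpairsPdep/idP.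
  move=> [i [k [_ + ->]]]; rewrite mem_iota add0n /= => ki.
  by rewrite inE => /kunz_coordP; rewrite leqNgt ki.
rewrite inE => /= nLn.
have r0 : (0 < n %% m)%N.
  by rewrite lt0n; apply/negP => r0; apply: nLn; apply/kunz_memP; rewrite r0.
have rm : (n %% m < m)%N by rewrite ltn_mod.
exists (n %% m)%N, (n %/ m)%N; rewrite !mem_iota add0n -divn_eq; split => //.
  lia.
rewrite /= ltnNge; apply/negP => /kunz_coordP; rewrite -divn_eq.
exact: nLn.
Qed.

(** Write [F = Q m + r]. The coordinate at [r] is [Q.+1]; the others are at most [Q.+1], and at most
    [Q] beyond [r]. Since [F + m] is not a sum of positive elements, [u] is opposed with bound
    [Q.+1] and [v] with bound [Q]. *)
Lemma strong_kunz : L != setT -> ~ weak L ->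
  kunz L \in kunz_candidates (genus L).
Proof.
move=> LT nw; have [Lm m0 mmin] := multP; have [L0 LD Lfin] := Ls.
have [nF gtF] := frobP Ls LT.
have Fm_ne := strong_sum_ne Ls LT nw Lm m0 mmin.
pose F := frob L; pose r := (F %% m)%N; pose Q := (F %/ m)%N.
have FE : F = (Q * m + r)%N by exact: divn_eq.
have rm : (r < m)%N by rewrite ltn_mod.
have r0 : (0 < r)%N.
  by rewrite lt0n; apply/negP => r0; apply: nF; apply/kunz_memP; rewrite r0.
pose c := kunz_coord L.
have c0 i : (0 < i < m)%N -> (0 < c i)%N by exact: kunz_coord_gt0.
have cQ i : (c i <= Q.+1)%N.
  by apply/kunz_coordP/gtF; rewrite -/F FE mulSn; lia.
have cQ1 i : (r < i)%N -> (c i <= Q)%N.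
  by move=> ri; apply/kunz_coordP/gtF; rewrite -/F FE; lia.
have cr : c r = Q.+1.
  apply/eqP; rewrite eqn_leq cQ ltnNge; apply/negP => /kunz_coordP.
  by rewrite -FE.
have Lc i k : (c i <= k)%N -> L (k * m + i)%N by move/kunz_coordP.
have lo i j : (0 < i)%N -> (0 < j)%N -> (i + j = r)%N -> (Q.+1 < c i + c j)%N.
  move=> i0 j0 ij; rewrite ltnNge; apply/negP => le.
  (* If [c i + c j <= Q.+1], both terms lie in [L] and add up to [Q.+1 * m + r = F + m]. *)
  apply: (@Fm_ne ((Q.+1 - c j) * m + i)%N (c j * m + j)%N).
  - by apply: Lc; lia.
  - exact: Lc.
  - by rewrite addn_gt0 i0 orbT.
  - by rewrite addn_gt0 j0 orbT.
  - rewrite -/F FE addnACA -mulnDl subnK ?mulSn; lia.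
have hi i j : (0 < i)%N -> (0 < j)%N -> (i + j = m + r)%N -> (Q < c i + c j)%N.
  move=> i0 j0 ij; rewrite ltnNge; apply/negP => le.
  apply: (@Fm_ne ((Q - c j) * m + i)%N (c j * m + j)%N).
  - by apply: Lc; lia.
  - exact: Lc.
  - by rewrite addn_gt0 i0 orbT.
  - by rewrite addn_gt0 j0 orbT.
  - rewrite -/F FE addnACA -mulnDl subnK; lia.
(* The genus is a sum of [m.-1] positive coordinates; this bounds the lengths of [u] and [v]. *)
have gs : (m.-1 <= genus L)%N.
  rewrite -sumn_kunz sumnE big_map -{1}(size_iota 1 m.-1) -sum1_size.
  rewrite big_seq [leqRHS]big_seq; apply: leq_sum => i.
  by rewrite mem_iota => im; apply: c0; lia.
pose u := [seq c i | i <- iota 1 r.-1].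
pose v := [seq c i | i <- iota r.+1 (m.-1 - r)].
have KE : kunz L = u ++ Q.+1 :: v.
  rewrite /kunz -cr -[c r :: v]/[seq c i | i <- r :: iota r.+1 (m.-1 - r)].
  rewrite -map_cat; congr map.
  have -> : (mult L).-1 = (r.-1 + (m.-1 - r).+1)%N by lia.
  by rewrite iotaD /=; congr (_ ++ _ :: iota _ _); lia.
have qg : (Q.+1 <= genus L)%N.
  by rewrite -sumn_kunz KE sumn_cat /=; lia.
have su : size u = r.-1 by rewrite size_map size_iota.
have sv : size v = (m.-1 - r)%N by rewrite size_map size_iota.
have nu i : (i < r.-1)%N -> nth 0%N u i = c i.+1.
  by move=> ir; rewrite (nth_map 0%N) ?size_iota// nth_iota.
have nv i : (i < m.-1 - r)%N -> nth 0%N v i = c (r.+1 + i)%N.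
  by move=> ir; rewrite (nth_map 0%N) ?size_iota// nth_iota.
apply/mapP; exists ((Q.+1, u), v) => //.
apply/allpairsPdep; exists (Q.+1, u), v; split => //.
- apply/allpairsPdep; exists Q.+1, u; split => //.
    by rewrite mem_iota; lia.
  apply/allpairsPdep; exists r.-1, u; split => //.
    by rewrite mem_iota; lia.
  apply: mem_opposed_lists => // i ir.
    by rewrite nu// cQ c0//; lia.
  by rewrite !nu//; [apply: lo|]; lia.
- apply/allpairsPdep; exists (m.-1 - r)%N, v; split => //.
    by rewrite mem_iota; lia.
  apply: mem_opposed_lists => // i ir.
    by rewrite nv//= cQ1 ?c0//; lia.
  by rewrite !nv//; [apply: hi|]; lia.
Qed.

End Kunz.

(** * Counting strong semigroups *)

Lemma kunz_inj (L1 L2 : set nat) : numerical_semigroup L1 ->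
  numerical_semigroup L2 -> kunz L1 = kunz L2 -> L1 = L2.
Proof.
move=> s1 s2 e; have m12 : mult L1 = mult L2 by rewrite -!size_kunz// e.
by apply/seteqP; split => n /kunz_memP h; apply/kunz_memP => //;
  [rewrite -m12 -e|rewrite m12 e]; exact: h.
Qed.

(** Distinct strong semigroups have distinct Kunz vectors among the candidates, each of weight
    exactly [(2/3) ^ g.+1], so the total weight bounds their number. *)
Lemma nstrong_bound (R : realFieldType) (g : nat) :
  (nstrong g.+1)%:R * (2 / 3) ^+ g.+1 <= 4 * g.+1%:R ^+ 3 :> R.
Proof.
pose A : seq (set nat) := fset_set (strong_semigroups g.+1).
have AP L : L \in A -> [/\ numerical_semigroup L, genus L = g.+1 & ~ weak L].
  by rewrite in_fset_set ?inE //; exact: finite_strong_semigroups.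
pose C := [seq s <- kunz_candidates g.+1 | sumn s == g.+1].
have le : (nstrong g.+1 <= size C)%N.
  rewrite /nstrong -(size_map kunz); apply: uniq_leq_size.
    rewrite map_inj_in_uniq ?fset_uniq// => L1 L2 /AP[s1 _ _] /AP[s2 _ _].
    exact: kunz_inj.
  move=> _ /mapP[L /AP[Ls Lg nw] ->].
  rewrite mem_filter sumn_kunz// Lg eqxx -Lg strong_kunz//.
  by rewrite -positive_genus// Lg.
apply: le_trans (kunz_candidates_weight R g.+1).
apply: (@le_trans _ _ (\sum_(s <- C) (2 / 3) ^+ sumn s)).
  rewrite big_filter (eq_bigr (fun=> (2 / 3) ^+ g.+1)); last first.
    by move=> s /eqP ->.
  rewrite -big_filter big_const_seq count_predT iter_addr_0 -[leRHS]mulr_natl.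
  by rewrite ler_wpM2r ?exprn_ge0 ?ler_nat//; lra.
rewrite big_filter [leRHS](bigID (fun s => sumn s == g.+1)) /= lerDl.
by apply: sumr_ge0 => s _; rewrite exprn_ge0//; lra.
Qed.

(** * Asymptotics *)

Lemma cvg_contraction (R : realType) (r : R) (u e : R^nat) : 0 <= r < 1 ->
  e @ \oo --> 0 -> (forall n, `|u n.+1| <= r * `|u n| + e n) ->
  u @ \oo --> 0.
Proof.
move=> /andP[r0 r1] e0 ue; apply/cvgr0Pnorm_le => eps eps0.
have r1' : 0 < 1 - r by rewrite subr_gt0.
(* The factor [1 - r] keeps the constant [eps / 2] stable under the recurrence: [r * (eps / 2) + (1
   - r) * (eps / 2) = eps / 2]. *)
have [n0 _ hn0] : \forall n \near \oo, e n <= eps / 2 * (1 - r).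
  by apply: cvgr_le e0 _ _; rewrite mulr_gt0// divr_gt0.
have H j : `|u (n0 + j)%N| <= r ^+ j * `|u n0| + eps / 2.
  elim: j => [|j IH]; first by rewrite addn0 expr0 mul1r lerDl; lra.
  rewrite addnS; apply: le_trans (ue _) _.
  have := hn0 (n0 + j)%N (leq_addr _ _); rewrite exprS /=; nra.
have [j0 _ hj0] : \forall j \near \oo, geometric `|u n0| r j <= eps / 2.
  apply: cvgr_le (cvg_geometric _ _) _ _; first by rewrite ger0_norm.
  by rewrite divr_gt0.
exists (n0 + j0)%N => // n /= le.
have -> : n = (n0 + (n - n0))%N by lia.
apply: le_trans (H _) _.
have le' : (j0 <= n - n0)%N by lia.
by have := hj0 _ le'; rewrite /= mulrC; lra.
Qed.

Section Asymptotics.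
Variable R : realType.
Local Notation phi := (@Defs.phi R).
Local Notation psi := (phi^-1).

Lemma phi_gt : 8 / 5 < phi.
Proof.
have : 11 / 5 < Num.sqrt 5 :> R.
  have := @sqr_sqrtr R 5 (ler0n _ _); have := sqrtr_ge0 (5 : R).
  by rewrite expr2; nra.
by rewrite /Defs.phi; lra.
Qed.

Let phi0 : 0 < phi.
Proof. by have := phi_gt; lra. Qed.

Lemma phi_sqr : phi ^+ 2 = phi + 1.
Proof.
have := @sqr_sqrtr R 5 (ler0n _ _).
by rewrite /Defs.phi !expr2 => h; lra.
Qed.

Lemma psi_sqr : psi ^+ 2 = 1 - psi.
Proof.
have e : phi * psi = 1 by rewrite mulfV// gt_eqF.
have -> : psi ^+ 2 = (phi * psi) ^+ 2 - phi * psi * psi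
    - psi ^+ 2 * (phi ^+ 2 - phi - 1) by ring.
by rewrite e phi_sqr; ring.
Qed.

Let psi01 : 0 < psi < 1.
Proof. by rewrite invr_gt0 phi0 invf_lt1//; have := phi_gt; lra. Qed.

Lemma expr_phiN (h : nat) : phi ^ (- h%:Z - 2) = psi ^+ h.+2.
Proof. by rewrite exprzD_Nnat -!exprnN -!exprVn -exprD addn2. Qed.

(* Absorbs the factor [g ^ 3] of [nstrong_bound] in [nstrong_cvg], because
   [3 / 2 * (50 / 49) ^ 3 < 8 / 5 < phi]. *)
Lemma natmul_expr_le (n : nat) : n%:R * (49 / 50) ^+ n <= 49 :> R.
Proof.
(* Bernoulli's inequality. *)
have : 1 + n%:R / 49 <= (50 / 49) ^+ n :> R.
  elim: n => [|n IH]; first by rewrite mul0r addr0.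
  rewrite exprS -natr1; have := ler0n R n; nra.
have -> : 50 / 49 = (49 / 50)^-1 :> R by field.
rewrite exprVn => h.
have e0 : 0 < (49 / 50) ^+ n :> R by rewrite exprn_gt0//; lra.
have : (1 + n%:R / 49) * (49 / 50) ^+ n <= 1 :> R.
  by rewrite -ler_pdivlMr// div1r.
nra.
Qed.

Lemma nstrong_cvg : (nstrong g.+1)%:R / phi ^+ g.+1 @[g --> \oo] --> 0.
Proof.
pose b : R := 3 / 2 * (50 / 49) ^+ 3.
have bphi : 0 <= b / phi < 1.
  have b0 : 0 <= b by rewrite /b; lra.
  rewrite divr_ge0 ?(ltW phi0)//= ltr_pdivrMr// mul1r.
  by apply: le_lt_trans phi_gt; rewrite /b; lra.
have H : geometric (4 * 49 ^+ 3) (b / phi) n @[n --> \oo] --> 0.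
  by apply: cvg_geometric; rewrite ger0_norm//; case/andP: bphi.
rewrite -cvg_shiftS in H.
apply: squeeze_cvgr (cvg_cst 0) H; near=> g => /=.
rewrite divr_ge0 ?exprn_ge0 ?(ltW phi0)//=.
rewrite [(b / phi) ^+ _]expr_div_n [leRHS]mulrA ler_pM2r ?invr_gt0 ?exprn_gt0//.
have x0 : 0 < (2 / 3) ^+ g.+1 :> R by rewrite exprn_gt0//; lra.
rewrite -(ler_pM2r x0); apply: le_trans (nstrong_bound R g) _.
rewrite -[leRHS]mulrA -[leRHS]mulrA ler_pM2l// -exprMn /b.
have -> : 3 / 2 * (50 / 49) ^+ 3 * (2 / 3) = ((49 / 50) ^+ 3)^-1 :> R by field.
rewrite exprVn ler_pdivlMr; last by rewrite !exprn_gt0// divr_gt0.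
rewrite -exprM mulnC exprM -exprMn ler_pXn2r ?nnegrE ?natmul_expr_le//.
Unshelve. all: by end_near. Qed.

Variable S : R.
Hypothesis N_cvg : (N g)%:R / phi ^+ g @[g --> \oo] --> S.

(** Induction on [k]. Since [t g.+1 k] is [tail g.+1 k - tail g.+1 k.+1] and is within
    [nstrong g.+1] of [tail g k.+1], the ratio [z g] of [tail g k.+1] to [phi ^ g] satisfies
    [z (g + 1) = S psi ^ k - psi z g] up to a vanishing error. The fixed point is [S psi ^ (k + 1)],
    because [psi ^ 2 = 1 - psi]. *)
Lemma tail_cvg (k : nat) :
  (tail g k)%:R / phi ^+ g @[g --> \oo] --> S * psi ^+ k.
Proof.
elim: k => [|k IH].
  by rewrite expr0 mulr1; under eq_fun do rewrite tail0.
pose x g : R := (tail g k)%:R / phi ^+ g - S * psi ^+ k.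
have x0 : x g @[g --> \oo] --> 0.
  by rewrite -(subrr (S * psi ^+ k)); apply: cvgB => //; exact: cvg_cst.
rewrite -cvg_shiftS in x0.
pose y g : R := (tail g k.+1)%:R / phi ^+ g - S * psi ^+ k.+1.
suff y0 : y g @[g --> \oo] --> 0.
  have -> : (fun g => (tail g k.+1)%:R / phi ^+ g) =
      (fun g => y g + S * psi ^+ k.+1).
    by apply/funext => g; rewrite /y subrK.
  by rewrite -[X in _ --> X]add0r; apply: cvgD => //; exact: cvg_cst.
have [p0 p1] := andP psi01.
apply: (@cvg_contraction _ psi y
  (fun g => `|x g.+1| + (nstrong g.+1)%:R / phi ^+ g.+1)).
- by rewrite (ltW p0).
- rewrite -(addr0 0); apply: cvgD; last exact: nstrong_cvg.
  by rewrite -(normr0 R); apply: cvg_norm.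
move=> g.
pose d : R := (t g.+1 k)%:R - (tail g k.+1)%:R.
have dn : `|d| <= (nstrong g.+1)%:R.
  have := t_le_tail g k; have := tail_le_t g k.
  rewrite -!(ler_nat R) !natrD /d ler_norml => h1 h2; apply/andP; split; lra.
have -> : y g.+1 = x g.+1 - psi * y g - d / phi ^+ g.+1.
  rewrite /x /y /d [tail g.+1 k]tailS natrD exprS invfM.
  have -> : S * psi ^+ k = S * psi ^+ k.+1 + psi * (S * psi ^+ k.+1).
    by rewrite exprS; have := psi_sqr; rewrite expr2 => h; ring: h.
  ring.
apply: le_trans (ler_normB _ _) _.
rewrite addrA lerD//.
  rewrite addrC; apply: le_trans (ler_normB _ _) _.
  by rewrite normrM (gtr0_norm p0) addrC.
rewrite normrM [X in _ * X]ger0_norm ?invr_ge0 ?exprn_ge0 ?(ltW phi0)//.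
by rewrite ler_wpM2r// invr_ge0 exprn_ge0 ?(ltW phi0).
Qed.

Lemma t_cvg (h : nat) :
  (t g h)%:R / phi ^+ g @[g --> \oo] --> S * psi ^+ h.+2.
Proof.
have -> : (fun g => (t g h)%:R / phi ^+ g) =
    (fun g => (tail g h)%:R / phi ^+ g - (tail g h.+1)%:R / phi ^+ g).
  by apply/funext => g; rewrite tailS natrD; ring.
have -> : S * psi ^+ h.+2 = S * psi ^+ h - S * psi ^+ h.+1.
  by rewrite -addn2 exprD psi_sqr exprS; ring.
by apply: cvgB; exact: tail_cvg.
Qed.

(** * Summed discrepancies *)

Lemma discrepancyE (g h : nat) :
  discrepancy S g h = `|(t g h)%:R - S * phi ^+ g * psi ^+ h.+2|.
Proof.
rewrite /discrepancy -addrA -mulrA; congr (`|_ - _ * _|).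
have p0 : phi != 0 by rewrite gt_eqF.
by rewrite expfzDr// -exprnP expr_phiN.
Qed.

Hypothesis S0 : 0 < S.

(** From index [k] on, each discrepancy is at most the sum of its two terms, and both telescope:
    [t g h = tail g h - tail g h.+1] and [psi ^ (h + 2) = psi ^ h - psi ^ (h + 1)]. *)
Lemma series_discrepancy_le (g k n : nat) : series (discrepancy S g) n <=
  series (discrepancy S g) k + (tail g k)%:R + S * phi ^+ g * psi ^+ k.
Proof.
have D0 h : 0 <= discrepancy S g h by rewrite normr_ge0.
have [p0 p1] := andP psi01.
have c0 : 0 <= S * phi ^+ g by rewrite mulr_ge0 ?exprn_ge0 //; exact: ltW.
have cp j : 0 <= S * phi ^+ g * psi ^+ j.
  by rewrite mulr_ge0 ?exprn_ge0 //; exact: ltW.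
have [nk|/ltnW/subnKC <-] := leqP n k.
  rewrite -addrA ler_wpDr ?addr_ge0//.
  exact: (nondecreasing_series (fun h _ _ => D0 h)).
elim: (n - k)%N => [|j IH].
  by rewrite addn0 -addrA lerDl addr_ge0.
(* Keeping the remaining tails on the left makes that side nonincreasing in [i]. *)
suff E i : series (discrepancy S g) (k + i)%N + (tail g (k + i)%N)%:R +
    S * phi ^+ g * psi ^+ (k + i)%N <= series (discrepancy S g) k +
    (tail g k)%:R + S * phi ^+ g * psi ^+ k.
  by apply: le_trans (E j.+1); rewrite -addrA lerDl addr_ge0.
elim: i => [|i IHi]; first by rewrite addn0.
rewrite addnS; apply: le_trans IHi.
rewrite [tail g (k + i)%N]tailS natrD seriesSr discrepancyE.
have -> : psi ^+ (k + i) = psi ^+ (k + i).+1 + psi ^+ (k + i).+2.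
  by rewrite -addn2 -[(k + i).+1]addn1 !exprD psi_sqr expr1; ring.
have := ler_normB (t g (k + i)%N)%:R (S * phi ^+ g * psi ^+ (k + i).+2).
by rewrite normr_nat (ger0_norm (cp _)) mulrDr; lra.
Qed.

Lemma is_cvg_series_discrepancy (g : nat) : cvgn (series (discrepancy S g)).
Proof.
apply: nondecreasing_is_cvgn.
  by apply: nondecreasing_series => h _ _; rewrite normr_ge0.
exists (series (discrepancy S g) 0 + (tail g 0)%:R + S * phi ^+ g * psi ^+ 0).
by move=> _ [n _ <-]; exact: series_discrepancy_le.
Qed.

Lemma series_discrepancy_cvg (k : nat) :
  series (discrepancy S g) k / phi ^+ g @[g --> \oo] --> 0.
Proof.
elim: k => [|k IH].
  under eq_fun do rewrite /series /= big_geq// mul0r.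
  exact: cvg_cst.
under eq_fun do rewrite seriesSr mulrDl.
rewrite -(addr0 0); apply: cvgD => //.
have := @t_cvg k; move=> /(cvgB)/(_ (cvg_cst (S * psi ^+ k.+2))).
rewrite subrr => /cvg_norm; rewrite normr0; apply: cvg_trans.
apply: near_eq_cvg; near=> g.
rewrite discrepancyE -[X in _ = _ * X]gtr0_norm ?invr_gt0 ?exprn_gt0//.
rewrite -normrM mulrBl; congr (`|_ - _|).
by rewrite mulrAC -[S * _ / _]mulrA mulfV ?mulr1// expf_neq0// gt_eqF.
Unshelve. all: by end_near. Qed.

(** Divided by [phi ^ g], the bound of [series_discrepancy_le] tends to [2 S psi ^ k] for fixed [k],
    since the first [k] discrepancies vanish in the limit. Then [k] is taken large. *)
Lemma lim_series_discrepancy_littleo :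
  (fun g : nat => limn (series (discrepancy S g)))
    =o_\oo (fun g : nat => phi ^+ g).
Proof.
have [p0 p1] := andP psi01.
apply/eqoP => eps eps0.
(* Half of [eps], because the mass beyond [k] enters twice: through [tail g k] and through the
   geometric terms. *)
have [k hk] : exists k, S * psi ^+ k < eps / 2.
  have : geometric S psi n @[n --> \oo] --> 0.
    by apply: cvg_geometric; rewrite gtr0_norm.
  move=> /cvgr_lt/(_ (eps / 2)); rewrite divr_gt0// => /(_ isT)[k _ kh].
  by exists k; exact: (kh k (leqnn k)).
have H : series (discrepancy S g) k / phi ^+ g + (tail g k)%:R / phi ^+ g
    @[g --> \oo] --> 0 + S * psi ^+ k.
  by apply: cvgD; [exact: series_discrepancy_cvg|exact: tail_cvg].
rewrite add0r in H.
near=> g.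
have g0 : 0 < phi ^+ g by rewrite exprn_gt0.
rewrite [X in _ <= _ * X]gtr0_norm// ger0_norm; last first.
  apply: limr_ge; first exact: is_cvg_series_discrepancy.
  near=> n; apply: sumr_ge0 => h _; exact: normr_ge0.
apply: (@limr_le _ _ _ R _ (series (discrepancy S g))).
  exact: is_cvg_series_discrepancy.
near=> n; apply: le_trans (series_discrepancy_le g k n) _.
rewrite -ler_pdivrMr// !mulrDl.
have -> : S * phi ^+ g * psi ^+ k / phi ^+ g = S * psi ^+ k.
  by rewrite mulrAC -[S * _ / _]mulrA mulfV ?mulr1// gt_eqF.
rewrite [leRHS](splitr eps); apply: lerD; last exact: ltW.
near: g; exact: (cvgr_le _ H).
Unshelve. all: by end_near. Qed.

Lemma t_over_N_cvg (h : nat) :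
  (t g h)%:R / (N g)%:R @[g --> \oo] --> phi ^ (- h%:Z - 2).
Proof.
have -> : phi ^ (- h%:Z - 2) = S * psi ^+ h.+2 / S.
  by rewrite expr_phiN mulrAC mulfV ?gt_eqF// mul1r.
have H : (t g h)%:R / phi ^+ g / ((N g)%:R / phi ^+ g) @[g --> \oo] -->
    S * psi ^+ h.+2 / S.
  exact: (cvgM (@t_cvg h) (cvgV (lt0r_neq0 S0) N_cvg)).
apply: cvg_trans H; apply: near_eq_cvg; near=> g.
by rewrite invf_div mulrA divfK// expf_neq0// gt_eqF.
Unshelve. all: by end_near. Qed.

End Asymptotics.


Theorem theorem2 (R : realType) (S : R)
  (hS : (N g)%:R / phi ^+ g @[g --> \oo] --> S) (hS0 : 0 < S) :
  [/\ forall g : nat, cvgn (series (discrepancy S g)),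
      (fun g : nat => limn (series (discrepancy S g)))
        =o_\oo (fun g : nat => (phi : R) ^+ g)
    & forall h : nat,
        (t g h)%:R / (N g)%:R @[g --> \oo] --> (phi : R) ^ (- h%:Z - 2)].
Proof.
split.
- by move=> g; exact: is_cvg_series_discrepancy.
- exact: lim_series_discrepancy_littleo.
- by move=> h; exact: t_over_N_cvg hS hS0 h.
Qed.
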